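(* The group $\Gamma_d(q)$ has property $R_\infty$ for all $d\ge 3$.
   Context: Let $d\ge 2$ and $q\ge 2$ be integers such that $d\le p+1$ for every prime $p$ dividing $q$, and write $\mathbb Z_q=\mathbb Z/q\mathbb Z$. Fix $l_1=0$ and $l_2,\dots,l_{d-1}\in\mathbb Z_q$ such that $l_i-l_j$ is invertible in $\mathbb Z_q$ whenever $i\ne j$. Let $\mathcal R_d(\mathbb Z_q)=\mathbb Z_q[t,(t+l_1)^{-1},\dots,(t+l_{d-1})^{-1}]$ (the localization of $\mathbb Z_q[t]$ at the elements $t+l_i$), and let $\Gamma_d(q)$ be the group, under matrix multiplication, of matrices $\begin{pmatrix}\prod_{i=1}^{d-1}(t+l_i)^{k_i} & P\\ 0&1\end{pmatrix}$ with $k_i\in\mathbb Z$, $P\in\mathcal R_d(\mathbb Z_q)$. For an automorphism $\varphi$ of a group $G$, elements $g,h\in G$ are $\varphi$-twisted conjugate if $sg\varphi(s)^{-1}=h$ for some $s\in G$; this is an equivalence relation whose classes are the $\varphi$-twisted conjugacy classes. $G$ has property $R_\infty$ if every $\varphi\in\mathrm{Aut}(G)$ has infinitely many $\varphi$-twisted conjugacy classes. *)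

(* Defs.v *)
From HB Require Import structures.
From mathcomp Require Import all_boot all_order all_algebra.
From mathcomp Require Import generic_quotient ring.
From mathcomp Require Import boolp classical_sets cardinality.

Set Implicit Arguments.
Unset Strict Implicit.
Unset Printing Implicit Defensive.

Import GRing.Theory.

Section TwistedConjugacy.
Local Open Scope group_scope.
Variables (G : groupType) (phi : G -> G).

Definition twisted_conj (g h : G) : Prop :=
  exists s : G, s * g * (phi s)^-1 = h.

Definition twisted_class (g : G) : set G := [set h | twisted_conj g h]%classic.

Definition twisted_classes : set (set G) := range twisted_class.

Hypothesis phiM : {morph phi : x y / x * y}.

Lemma mul_morph1 : phi 1 = 1.
Proof. by apply: (@mulgI _ (phi 1)); rewrite -phiM !mulg1. Qed.

Lemma mul_morphV s : phi s^-1 = (phi s)^-1.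
Proof. by apply: (@mulgI _ (phi s)); rewrite -phiM !mulgV mul_morph1. Qed.

Lemma twisted_conj_refl g : twisted_conj g g.
Proof. by exists 1; rewrite mul_morph1 mul1g invg1 mulg1. Qed.

Lemma twisted_conj_sym g h : twisted_conj g h -> twisted_conj h g.
Proof.
by move=> [s <-]; exists s^-1; rewrite mul_morphV invgK !mulgA mulVg mul1g mulgVK.
Qed.

Lemma twisted_conj_trans g h k :
  twisted_conj g h -> twisted_conj h k -> twisted_conj g k.
Proof. by move=> [s <-] [u <-]; exists (u * s); rewrite phiM invgM !mulgA. Qed.

End TwistedConjugacy.

Definition has_Rinfty (G : groupType) : Prop :=
  forall phi : {multiplicative G -> G},
    bijective phi -> infinite_set (twisted_classes phi).

Local Open Scope ring_scope.

(* LocPoly.type l is the localization A[t, (t + l_1)^-1, ..., (t + l_m)^-1];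
   A may have zero divisors, so {fraction _} does not apply.  The pair (P, k)
   stands for the fraction P / \prod_i (t + l_i) ^ k_i.  The denominators are
   monic, hence regular, so the general criterion for equality of fractions
   (u * (P * s' - P' * s) = 0 for some u in the multiplicative set) amounts to
   cross-multiplication.  See loc_fracP, toloc_inj and loc_unit_gen below. *)
Module LocPoly.
Section LocPoly.
Local Open Scope quotient_scope.
Variables (A : comNzRingType) (m : nat) (l : 'I_m -> A).

Definition preloc : Type := ({poly A} * {ffun 'I_m -> nat})%type.
HB.instance Definition _ := Choice.on preloc.

Definition den (k : {ffun 'I_m -> nat}) : {poly A} :=
  \prod_(i < m) ('X + (l i)%:P) ^+ k i.

Definition exp_add (j k : {ffun 'I_m -> nat}) : {ffun 'I_m -> nat} :=
  [ffun i => (j i + k i)%N].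
Definition exp0 : {ffun 'I_m -> nat} := [ffun=> 0%N].

Lemma den_add j k : den (exp_add j k) = den j * den k.
Proof.
by rewrite /den -big_split /=; apply: eq_bigr => i _; rewrite ffunE exprD.
Qed.

Lemma den0 : den exp0 = 1.
Proof. by rewrite /den big1 // => i _; rewrite ffunE expr0. Qed.

Lemma den_monic k : den k \is monic.
Proof. by apply: monic_prod => i _; rewrite monic_exp // monicXaddC. Qed.

Lemma den_inj k : injective (fun p => p * den k).
Proof. exact/monic_rreg/den_monic. Qed.

Definition equivloc (x y : preloc) := x.1 * den y.2 == y.1 * den x.2.

Lemma equivloc_refl : reflexive equivloc.
Proof. by move=> x; rewrite /equivloc. Qed.

Lemma equivloc_sym : symmetric equivloc.
Proof. by move=> x y; rewrite /equivloc eq_sym. Qed.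

Lemma equivloc_trans : transitive equivloc.
Proof.
move=> y x z; rewrite /equivloc => /eqP xy /eqP yz; apply/eqP.
by apply: (@den_inj y.2); rewrite /= mulrAC xy mulrAC yz mulrAC.
Qed.

Canonical equivloc_equiv :=
  EquivRel equivloc equivloc_refl equivloc_sym equivloc_trans.

Definition type := {eq_quot equivloc}.
HB.instance Definition _ : EqQuotient _ equivloc type := EqQuotient.on type.
HB.instance Definition _ := Choice.on type.

Lemma equivloc_l (x : preloc) :
  (repr (\pi_type x)).1 * den x.2 = x.1 * den (repr (\pi_type x)).2.
Proof. by apply/eqP; rewrite -[_ == _]/(equivloc _ _) -eqmodE reprK. Qed.

Definition toloc := lift_embed type (fun p : {poly A} => (p, exp0) : preloc).
Canonical toloc_pi_morph := PiEmbed toloc.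

Definition addf (x y : preloc) : preloc :=
  (x.1 * den y.2 + y.1 * den x.2, exp_add x.2 y.2).
Definition add := lift_op2 type addf.
Lemma pi_add : {morph \pi : x y / addf x y >-> add x y}.
Proof.
move=> x y; unlock add; apply/eqmodP => /=; rewrite /equivloc /= !den_add.
have := equivloc_l x; have := equivloc_l y.
set y' := repr _; set x' := repr _ => ey ex; apply/eqP.
transitivity ((x.1 * den x'.2) * (den y.2 * den y'.2)
  + (y.1 * den y'.2) * (den x.2 * den x'.2)); first by ring.
by rewrite -ex -ey; ring.
Qed.
Canonical pi_add_morph := PiMorph2 pi_add.

Definition oppf (x : preloc) : preloc := (- x.1, x.2).
Definition opp := lift_op1 type oppf.
Lemma pi_opp : {morph \pi : x / oppf x >-> opp x}.
Proof.
move=> x; unlock opp; apply/eqmodP => /=; rewrite /equivloc /=.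
by rewrite !mulNr equivloc_l.
Qed.
Canonical pi_opp_morph := PiMorph1 pi_opp.

Definition mulf (x y : preloc) : preloc := (x.1 * y.1, exp_add x.2 y.2).
Definition mul := lift_op2 type mulf.
Lemma pi_mul : {morph \pi : x y / mulf x y >-> mul x y}.
Proof.
move=> x y; unlock mul; apply/eqmodP => /=; rewrite /equivloc /= !den_add.
by rewrite mulrACA -!equivloc_l mulrACA.
Qed.
Canonical pi_mul_morph := PiMorph2 pi_mul.

Lemma addA : associative add.
Proof.
elim/quotW=> x; elim/quotW=> y; elim/quotW=> z; apply/eqP.
by rewrite !piE /equivloc /addf /= !den_add; apply/eqP; ring.
Qed.

Lemma addC : commutative add.
Proof.
elim/quotW=> x; elim/quotW=> y; apply/eqP.
by rewrite !piE /equivloc /addf /= !den_add; apply/eqP; ring.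
Qed.

Lemma add0_l : left_id (toloc 0) add.
Proof.
elim/quotW=> x; apply/eqP.
by rewrite !piE /equivloc /addf /= !den_add den0; apply/eqP; ring.
Qed.

Lemma addN_l : left_inverse (toloc 0) opp add.
Proof.
elim/quotW=> x; apply/eqP.
by rewrite !piE /equivloc /addf /oppf /= !den_add den0; apply/eqP; ring.
Qed.

HB.instance Definition _ := GRing.isZmodule.Build type addA addC add0_l addN_l.

Lemma mulA : associative mul.
Proof.
elim/quotW=> x; elim/quotW=> y; elim/quotW=> z; apply/eqP.
by rewrite !piE /equivloc /mulf /= !den_add; apply/eqP; ring.
Qed.

Lemma mulC : commutative mul.
Proof.
elim/quotW=> x; elim/quotW=> y; apply/eqP.
by rewrite !piE /equivloc /mulf /= !den_add; apply/eqP; ring.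
Qed.

Lemma mul1_l : left_id (toloc 1) mul.
Proof.
elim/quotW=> x; apply/eqP.
by rewrite !piE /equivloc /mulf /= !den_add den0; apply/eqP; ring.
Qed.

Lemma mul_addl : left_distributive mul add.
Proof.
elim/quotW=> x; elim/quotW=> y; elim/quotW=> z; apply/eqP.
by rewrite !piE /equivloc /mulf /addf /= !den_add; apply/eqP; ring.
Qed.

Lemma nonzero1 : toloc 1 != toloc 0 :> type.
Proof. by rewrite piE /equivloc /= den0 !mulr1 oner_eq0. Qed.

HB.instance Definition _ :=
  GRing.Zmodule_isComNzRing.Build type mulA mulC mul1_l mul_addl nonzero1.

Definition unit : {pred type} := fun x => `[< exists y : type, y * x = 1 >].

Definition inv (x : type) : type :=
  if pselect (exists y : type, y * x = 1) is left ex then sval (cid ex) else x.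

Lemma mulVx : {in unit, left_inverse 1 inv *%R}.
Proof.
by move=> x /asboolP ux; rewrite /inv; case: pselect => // ex; case: cid.
Qed.

Lemma unitPl (x y : type) : y * x = 1 -> unit x.
Proof. by move=> yx; apply/asboolP; exists y. Qed.

Lemma inv_out : {in [predC unit], inv =1 id}.
Proof.
by move=> x /negP ux; rewrite /inv; case: pselect => // ex; case: ux; apply/asboolP.
Qed.

HB.instance Definition _ :=
  GRing.ComNzRing_hasMulInverse.Build type mulVx unitPl inv_out.

Lemma toloc_is_zmod_morphism : zmod_morphism toloc.
Proof.
move=> p q; apply/eqP; rewrite -[toloc p - toloc q]/(add (toloc p) (opp (toloc q))).
by rewrite !piE /equivloc /addf /oppf /= !den_add den0 !mulr1.
Qed.
HB.instance Definition _ :=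
  GRing.isZmodMorphism.Build {poly A} type toloc toloc_is_zmod_morphism.

Lemma toloc_is_monoid_morphism : monoid_morphism toloc.
Proof.
split=> // p q; apply/eqP; rewrite -[toloc p * toloc q]/(mul (toloc p) (toloc q)).
by rewrite !piE /equivloc /mulf /= !den_add den0 !mulr1.
Qed.
HB.instance Definition _ :=
  GRing.isMonoidMorphism.Build {poly A} type toloc toloc_is_monoid_morphism.

Lemma toloc_inj : injective toloc.
Proof.
move=> p q /eqP; rewrite piE /equivloc /= den0 !mulr1; exact: eqP.
Qed.

Lemma pi_den (p : {poly A}) k : \pi_type (p, k) * toloc (den k) = toloc p.
Proof.
apply/eqP; rewrite -[_ * _]/(mul _ _) !piE /equivloc /mulf /= den_add den0.
by rewrite !mulr1.
Qed.

Definition gen (i : 'I_m) : type := toloc ('X + (l i)%:P).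

Lemma loc_unit_gen i : gen i \is a GRing.unit.
Proof.
apply/asboolP; exists (\pi_type (1, [ffun j => (j == i) : nat])).
have <- : toloc 1 = 1 by rewrite rmorph1.
rewrite -(pi_den 1 [ffun j => (j == i) : nat]); congr (_ * toloc _).
rewrite /den (bigD1 i) //= ffunE eqxx expr1 big1 ?mulr1 // => j /negPf ne.
by rewrite ffunE ne expr0.
Qed.

Lemma loc_fracP (x : type) :
  exists p, exists k : 'I_m -> nat, x * \prod_(i < m) gen i ^+ k i = toloc p.
Proof.
elim/quotW: x => -[p k]; exists p, k; rewrite -(pi_den p k) /den rmorph_prod.
by congr (_ * _); apply: eq_bigr => i _; rewrite rmorphXn.
Qed.

End LocPoly.
End LocPoly.
HB.export LocPoly.

Notation locpoly := LocPoly.type.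
Notation locgen := LocPoly.gen.

Section Gamma.
Variables (A : comNzRingType) (m : nat) (l : 'I_m -> A).

Definition affmx (R : nzRingType) (u p : R) : 'M[R]_2 :=
  block_mx (u%:M : 'M_1) (p%:M : 'M_1) (0 : 'M_1) (1%:M : 'M_1).

Lemma mul_affmx (R : nzRingType) (u p v r : R) :
  affmx u p *m affmx v r = affmx (u * v) (u * r + p).
Proof.
rewrite /affmx [LHS](@mulmx_block _ 1 1 1 1 1 1).
by rewrite !mulmx0 !mul0mx !addr0 !add0r !mulmx1 -!scalar_mxM -raddfD.
Qed.

Lemma affmx10 (R : nzRingType) : affmx (1 : R) 0 = 1%:M.
Proof. by rewrite /affmx raddf0 -(@scalar_mx_block _ 1 1). Qed.

Definition locmon (k : 'I_m -> int) : locpoly l := \prod_(i < m) locgen l i ^ k i.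

Lemma locmonD j k : locmon (fun i => j i + k i) = locmon j * locmon k.
Proof.
rewrite /locmon -big_split; apply: eq_bigr => i _.
by rewrite exprzDr ?LocPoly.loc_unit_gen.
Qed.

Lemma locmon0 : locmon (fun=> 0) = 1.
Proof. by rewrite /locmon big1. Qed.

Definition in_Gamma : pred 'M[locpoly l]_2 :=
  fun M => `[< exists (k : 'I_m -> int) (P : locpoly l), M = affmx (locmon k) P >].

Record Gamma := MkGamma { Gamma_mx : 'M[locpoly l]_2; _ : in_Gamma Gamma_mx }.
HB.instance Definition _ := [isSub for Gamma_mx].
HB.instance Definition _ := [Choice of Gamma by <:].

Fact Gamma_mul_proof (M N : Gamma) : in_Gamma (val M *m val N).
Proof.
case: M N => [M /= /asboolP[j [P ->]]] [N /= /asboolP[k [Q ->]]].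
apply/asboolP; exists (fun i => j i + k i), (locmon j * Q + P).
by rewrite mul_affmx locmonD.
Qed.

Fact Gamma_one_proof : in_Gamma 1%:M.
Proof. by apply/asboolP; exists (fun=> 0), 0; rewrite locmon0 affmx10. Qed.

Lemma affmx_inv k (P : locpoly l) :
  let N := affmx (locmon (fun i => - k i)) (- locmon (fun i => - k i) * P) in
  (N *m affmx (locmon k) P = 1%:M) * (affmx (locmon k) P *m N = 1%:M).
Proof.
have e : locmon (fun i => - k i) * locmon k = 1.
  rewrite -locmonD -[RHS]locmon0; by apply: eq_bigr => i _; rewrite addNr.
rewrite /= !mul_affmx !mulNr subrr mulrN mulrA (mulrC (locmon k)) e mul1r.
by rewrite addNr affmx10.
Qed.

Fact Gamma_inv_proof (M : Gamma) : in_Gamma (invmx (val M)).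
Proof.
case: M => [M /= /asboolP[k [P ->]]]; have [NM MN] := affmx_inv k P.
have [uM _] := mulmx1_unit MN.
apply/asboolP; exists (fun i => - k i), (- locmon (fun i => - k i) * P).
by rewrite -[LHS]mul1mx -NM mulmxK.
Qed.

Lemma Gamma_unitmx (M : Gamma) : val M \in unitmx.
Proof.
case: M => [M /= /asboolP[k [P ->]]]; have [_ MN] := affmx_inv k P.
by have [] := mulmx1_unit MN.
Qed.

Definition Gamma_mul (M N : Gamma) : Gamma := MkGamma (Gamma_mul_proof M N).
Definition Gamma_one : Gamma := MkGamma Gamma_one_proof.
Definition Gamma_inv (M : Gamma) : Gamma := MkGamma (Gamma_inv_proof M).

Lemma Gamma_mulA : associative Gamma_mul.
Proof. by move=> M N Q; apply: val_inj; rewrite /= mulmxA. Qed.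
Lemma Gamma_mul1g : left_id Gamma_one Gamma_mul.
Proof. by move=> M; apply: val_inj; rewrite /= mul1mx. Qed.
Lemma Gamma_mulg1 : right_id Gamma_one Gamma_mul.
Proof. by move=> M; apply: val_inj; rewrite /= mulmx1. Qed.
Lemma Gamma_mulVg : left_inverse Gamma_one Gamma_inv Gamma_mul.
Proof. by move=> M; apply: val_inj; rewrite /= mulVmx ?Gamma_unitmx. Qed.
Lemma Gamma_mulgV : right_inverse Gamma_one Gamma_inv Gamma_mul.
Proof. by move=> M; apply: val_inj; rewrite /= mulmxV ?Gamma_unitmx. Qed.

HB.instance Definition _ := isGroup.Build Gamma
  Gamma_mulA Gamma_mul1g Gamma_mulg1 Gamma_mulVg Gamma_mulgV.

End Gamma.

(* Main.v *)
Require Import Defs.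
From HB Require Import structures.
From mathcomp Require Import all_boot all_order all_algebra.
From mathcomp Require Import ring zify.
From mathcomp Require Import boolp classical_sets cardinality.

Set Implicit Arguments.
Unset Strict Implicit.
Unset Printing Implicit Defensive.

Import GRing.Theory Num.Theory Order.TTheory.
Local Open Scope ring_scope.

(** Write [x_i] for [t + l_i], [R] for the localization, [m = d - 1], and [x^k]
for the monomial [\prod_i x_i ^ k_i].  The matrices with [k = 0] form a copy of
[R].  They are exactly the elements of order dividing [q], because the quotient
[Z^m] is torsion free, so an automorphism [phi] preserves them.  It induces an
additive bijection [psi] of [R] and an automorphism [beta] of [Z^m], linked by
[psi (x^k P) = x^(beta k) psi P] ([trans_map_mon]).  Applying [psi] to
[(x_i - x_k) P = (l_i - l_k) P], where [psi P = 1], shows that the monomials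
[u_i = x^(beta e_i)] satisfy [u_i - u_k = l_i - l_k] ([mon_expo_map_sub]).

These equations determine [beta].  Let [B i j] be the order of [u_i] at the
point [t = - l_j].  Among the orders [B i j], [B k j] and [0] of the three
terms, the smallest occurs twice: otherwise dividing by the term of smallest
order and evaluating at that point would give [0] equal to a unit
([mon_sub_const]).  As [B] is invertible over [Z], each column is a unit vector
or [(-1, .., -1)], and all columns differ ([tropical_dichotomy]).  In geometric
terms [phi] permutes the [d] places [- l_1, .., - l_m, oo].

If [oo] is fixed, [B] is a permutation matrix and the sum of the exponents is a
[phi]-invariant homomorphism onto [Z], which separates infinitely many twisted
classes ([infinite_twisted_of_fixed]).  If [oo] is moved, let [r] be the column
[(-1, .., -1)].  Two further columns [j], [j'] would give [x_j - x_j' = c x_r]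
for a constant [c], but at [- l_r] the left side is a unit and the right side
is [0]; so [m = 2], with one further column [s].  Either the order at [s] is
invariant, and the same argument applies, or [phi] acts as the 3-cycle
[x_r |-> x_s / x_r], [x_s |-> 1 / x_r] ([expo_mx_dichotomy]).  The 3-cycle
forces [l_s - l_r] to be both [1] and [-1], hence [q = 2] ([three_cycle_char2]).

For [q = 2] the 3-cycle cannot be excluded.  But then every unit of [R] is a
monomial ([locpoly_unit]), so some monomial [x^u] times [psi] is a map [rho]
with [rho 1 = 1].  Then [rho ^ 3 = 1], and [T = 1 + rho + rho ^ 2] takes equal
values at [P] and [Q] whenever the elements [(x^u, P)] and [(x^u, Q)] are
twisted conjugate.  The values [T (x_r ^ n)] are pairwise distinct
([infinite_twisted_three_cycle]). *)

(** * Integer matrices with tropical columns *)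

Section TropicalMatrix.
Variables (m : nat) (B : 'M[int]_m).
Hypothesis tropB : forall i k j, i != k ->
  (B i j < 0 -> B k j = B i j) /\ (0 < B i j -> B k j = 0).
Hypothesis surjB : forall v : 'rV[int]_m, exists u : 'rV_m, u *m B = v.

(** Equal columns would put every vector of the image of [B] in the hyperplane
where two coordinates agree. *)
Lemma col_inj j j' : col j B = col j' B -> j = j'.
Proof.
move=> ej; have [u uB] := surjB (delta_mx 0 j).
have : (u *m col j B) 0 0 = (u *m col j' B) 0 0 by rewrite ej.
rewrite !colE !mulmxA uB -!colE !mxE !eqxx /=.
by have [] := eqVneq j' j.
Qed.

(** A negative entry is repeated all along its column, and a positive entry is
alone in its column.  Either way the column is a multiple of the announced
vector, and surjectivity makes the factor invertible in [Z]. *)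
Lemma col_shape j : col j B = const_mx (-1) \/ exists i, col j B = delta_mx i 0.
Proof.
have [u uB] := surjB (delta_mx 0 j).
have {uB} u1 : \sum_i u 0 i * B i j = 1.
  by move/rowP/(_ j): uB; rewrite !mxE !eqxx.
have [[i Bi]|Bge] := pselect (exists i, B i j < 0).
  left; have Bk k : B k j = B i j.
    have [->//|ik] := eqVneq k i.
    by apply: (proj1 (tropB j _)) => //; rewrite eq_sym.
  have e : (\sum_i u 0 i) * B i j = 1.
    by rewrite -u1 mulr_suml; apply: eq_bigr => k _; rewrite Bk.
  apply/colP => k; rewrite !mxE Bk.
  move: (\sum_i _) (B i j) Bi e => x y y0 xy.
  have x0 : x < 0 by nia.
  by nia.
have [[i Bi]|Ble] := pselect (exists i, 0 < B i j).
  right; exists i; have Bk k : k != i -> B k j = 0.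
    by move=> ki; apply: (proj2 (tropB j _)) Bi; rewrite eq_sym.
  have e : u 0 i * B i j = 1.
    by rewrite -u1 (bigD1 i) //= big1 ?addr0 // => k /Bk ->; rewrite mulr0.
  apply/colP => k; rewrite !mxE eqxx andbT.
  have [->|/Bk//] := eqVneq k i; move: (u 0 i) (B i j) Bi e => x y y0 xy.
  have x0 : 0 < x by nia.
  by rewrite /=; nia.
have B0 i : B i j = 0.
  apply/le_anti/andP; split; rewrite leNgt; apply/negP => Bi.
    by apply: Ble; exists i.
  by apply: Bge; exists i.
by move: u1; rewrite big1 // => i _; rewrite B0 mulr0.
Qed.

(** In the first case the columns are all the unit vectors, in some order. *)
Lemma tropical_dichotomy :
  B *m const_mx 1 = const_mx 1 :> 'cV_m \/
  exists2 r, col r B = const_mx (-1) &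
    forall j, j != r -> exists i, col j B = delta_mx i 0.
Proof.
have [[r Br]|Bn] := pselect (exists r, col r B = const_mx (-1)).
  right; exists r => // j jr; have [Bj|//] := col_shape j.
  by case/eqP: jr; apply: col_inj; rewrite Bj.
left; have /fin_all_exists[t Bt] : forall j, exists i, col j B = delta_mx i 0.
  by move=> j; have [Bj|//] := col_shape j; case: Bn; exists j.
have t_inj : injective t by move=> j j' e; apply: col_inj; rewrite !Bt e.
apply/colP => i; rewrite !mxE.
transitivity (\sum_j (delta_mx j 0 : 'cV[int]_m) i 0).
  rewrite [RHS](reindex_inj t_inj); apply: eq_bigr => j _ /=.
  by rewrite -Bt !mxE mulr1.
rewrite (bigD1 i) //= mxE !eqxx big1 ?addr0 // => j ji.
by rewrite mxE eq_sym (negPf ji).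
Qed.

Lemma exceptional_row r i j : j != r ->
    col r B = const_mx (-1) ->
    (forall k, k != r -> exists i, col k B = delta_mx i 0) ->
  col j B = delta_mx i 0 -> row i B = delta_mx 0 j - delta_mx 0 r.
Proof.
move=> jr Br Bt Bj; apply/rowP => k; rewrite !mxE eqxx /=.
have [->|kr] := eqVneq k r.
  by move/colP/(_ i): Br; rewrite !mxE eq_sym (negPf jr) => ->.
have [->|kj] := eqVneq k j.
  by move/colP/(_ i): Bj; rewrite !mxE !eqxx => ->.
have [i' Bk] := Bt k kr; move/colP/(_ i): (Bk); rewrite !mxE eqxx andbT => ->.
have [e|//] := eqVneq i i'.
by case/eqP: kj; apply: col_inj; rewrite Bk Bj e.
Qed.

End TropicalMatrix.

(** * Counting twisted classes *)

Lemma infinite_twisted_classes (G : groupType) (phi : G -> G) :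
    {morph phi : x y / (x * y)%g} -> forall F : nat -> G,
    (forall a b, twisted_conj phi (F a) (F b) -> a = b) ->
  infinite_set (twisted_classes phi).
Proof.
move=> phiM F F_inj.
apply: (@sub_infinite_set _ (range (twisted_class phi \o F))).
  by move=> _ [n _ <-]; exists (F n).
have inj : {in setT &, injective (twisted_class phi \o F)}.
  move=> a b _ _ /= /(congr1 (fun C : set G => C (F b))) e; apply: F_inj.
  rewrite -[twisted_conj _ _ _]/(twisted_class phi (F a) (F b)) e.
  exact: twisted_conj_refl.
by rewrite (eq_finite_set (inj_card_eq inj)); exact: infinite_nat.
Qed.

(** * Monomials in the localization *)

Section Monomials.
Variables (A : comUnitRingType) (m : nat) (l : 'I_m -> A).
Local Notation R := (locpoly l).
Local Notation toloc := (@LocPoly.toloc A m l).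
Local Notation gen := (locgen l).

(** Row vectors of exponents, unlike functions, come with linear algebra over
[Z]. *)
Definition mon (k : 'rV[int]_m) : R := locmon l (k 0).

Lemma mon0 : mon 0 = 1.
Proof. by rewrite -[RHS](locmon0 l); apply: eq_bigr => i _; rewrite mxE. Qed.

Lemma monD j k : mon (j + k) = mon j * mon k.
Proof. by rewrite -[RHS]locmonD; apply: eq_bigr => i _; rewrite mxE. Qed.

Lemma monVr k : mon k * mon (- k) = 1.
Proof. by rewrite -monD subrr mon0. Qed.

Lemma mon_delta i : mon (delta_mx 0 i) = gen i.
Proof.
rewrite /mon /locmon (bigD1 i) //= big1 => [|j ji].
  by rewrite mxE !eqxx mulr1 expr1z.
by rewrite mxE eqxx (negPf ji) expr0z.
Qed.

Lemma prod_gen (s : seq 'I_m) :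
  \prod_(i <- s) gen i = mon (\sum_(i <- s) delta_mx 0 i).
Proof.
elim: s => [|i s IH]; first by rewrite !big_nil mon0.
by rewrite !big_cons monD mon_delta IH.
Qed.

Lemma loc_frac (r : R) :
  exists (s : seq 'I_m) (p : {poly A}), r * \prod_(i <- s) gen i = toloc p.
Proof.
have [p [k e]] := LocPoly.loc_fracP r.
exists (flatten [seq nseq (k i) i | i <- enum 'I_m]), p.
rewrite big_flatten big_map big_enum -e; congr (_ * _).
by apply: eq_bigr => i _; rewrite big_nseq iter_mulr_1.
Qed.

(** When the coefficients are multiples of [1], [R] is the additive monoid
generated by the monomials; this is how additive maps on [R] are controlled. *)
Lemma loc_ind (Q : R -> Prop) :
    (0 < m)%N -> (forall a : A, exists n : nat, a = n%:R) ->
    Q 0 -> (forall x y, Q x -> Q y -> Q (x + y)) -> (forall k, Q (mon k)) ->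
  forall r, Q r.
Proof.
move=> m0 cyclicA Q0 QD Qmon; pose i := Ordinal m0.
pose S r := forall k, Q (mon k * r).
have S0 k : Q (mon k * 0) by rewrite mulr0.
have SD r1 r2 : S r1 -> S r2 -> S (r1 + r2).
  by move=> s1 s2 k; rewrite mulrDr; apply: QD.
have SMn r n : S r -> S (r *+ n).
  by move=> Sr; elim: n => [|n IH]; rewrite ?mulr0n // mulrS; apply: SD.
have S1 : S 1 by move=> k; rewrite mulr1.
have Sgen r : S r -> S (gen i * r).
  by move=> Sr k; rewrite -mon_delta mulrA -monD.
(* 'X is gen i plus a natural number, so Horner's scheme uses sums only. *)
have Sp (p : {poly A}) : S (toloc p).
  elim/poly_ind: p => [|p c IH]; first by rewrite rmorph0.
  have [n en] := cyclicA (- l i); have [n' ->] := cyclicA c.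
  have -> : toloc (p * 'X + (n'%:R)%:P) =
      gen i * toloc p + toloc p *+ n + 1 *+ n'.
    rewrite -(rmorph1 toloc) -!raddfMn -rmorphM -!rmorphD; congr toloc.
    rewrite (rmorph_nat polyC n') -[p *+ n]mulr_natr -(rmorph_nat polyC n).
    by rewrite -en rmorphN /=; ring.
  by apply/(SD _ _ _ (SMn _ _ S1))/(SD _ _ (Sgen _ IH))/SMn.
move=> r; have [s [p e]] := loc_frac r.
have := Sp p (- \sum_(i <- s) delta_mx 0 i).
by rewrite -e prod_gen mulrCA [mon (- _) * _]mulrC monVr mulr1.
Qed.

(** * Vanishing at a finite place *)

(** The fractions regular at [t = - l j] form a ring, and those with a zero
there an ideal of it.  Over coefficients with zero divisors this ideal does
the work of a valuation. *)
Definition vanishes (j : 'I_m) (r : R) : Prop :=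
  exists2 s : seq 'I_m, j \notin s &
    exists p : {poly A}, r * \prod_(i <- s) gen i = toloc (p * ('X + (l j)%:P)).

Lemma vanishesD j r1 r2 :
  vanishes j r1 -> vanishes j r2 -> vanishes j (r1 + r2).
Proof.
move=> [s1 js1 [p1 e1]] [s2 js2 [p2 e2]].
exists (s1 ++ s2); first by rewrite mem_cat negb_or js1.
exists (p1 * \prod_(i <- s2) ('X + (l i)%:P) +
        p2 * \prod_(i <- s1) ('X + (l i)%:P)).
rewrite big_cat /= mulrDl mulrA e1 [r2 * _]mulrCA e2 mulrDl rmorphD /=.
by congr (_ + _); rewrite -rmorph_prod -rmorphM; congr toloc; ring.
Qed.

Lemma vanishesM j r p : vanishes j r -> vanishes j (r * toloc p).
Proof.
move=> [s js [p' e]]; exists s => //; exists (p' * p).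
by rewrite mulrAC e -rmorphM /= mulrAC.
Qed.

Lemma vanishesN j r : vanishes j r -> vanishes j (- r).
Proof. by move=> v; rewrite -mulrN1 -(rmorphN1 toloc); apply: vanishesM. Qed.

Lemma vanishesV j i r : i != j -> vanishes j r -> vanishes j (r / gen i).
Proof.
move=> ij [s js [p e]]; exists (i :: s).
  by rewrite inE negb_or eq_sym ij.
by exists p; rewrite big_cons -e mulrA divrK // LocPoly.loc_unit_gen.
Qed.

Lemma vanishes_mulmon j r (k : 'rV[int]_m) :
  0 <= k 0 j -> vanishes j r -> vanishes j (r * mon k).
Proof.
move=> kj vr; rewrite /mon /locmon.
have stepX i (n : nat) r' : vanishes j r' -> vanishes j (r' * gen i ^ n).
  by move=> v; rewrite -exprnP -rmorphXn; apply: vanishesM.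
pose closed (z : R) := forall r', vanishes j r' -> vanishes j (r' * z).
have {}stepX i : closed (gen i ^ k 0 i).
  move=> r' v; have [->|ij] := eqVneq i j.
    by case: (k 0 j) kj => // n _; apply: stepX.
  case: (k 0 i) => n; first exact: stepX.
  rewrite NegzE -exprnN; elim: n.+1 r' v => [|h IH] r' v.
    by rewrite expr0 invr1 mulr1.
  by rewrite -exprVn exprS mulrA exprVn; apply: IH; apply: vanishesV.
suff : closed (\prod_(i < m) gen i ^ k 0 i) by apply.
apply: (big_ind closed) => [r'|x y cx cy r' v|i _]; first by rewrite mulr1.
  by rewrite mulrA; apply/cy/cx.
exact: stepX.
Qed.

Lemma vanishes_mon j (k : 'rV[int]_m) : 0 < k 0 j -> vanishes j (mon k).
Proof.
move=> kj; rewrite -[k](subrK (delta_mx 0 j)) addrC monD.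
apply: vanishes_mulmon; first by rewrite !mxE !eqxx /= subr_ge0 -gtz0_ge1.
by exists [::] => //; exists 1; rewrite mon_delta big_nil mulr1 mul1r.
Qed.

Hypothesis hl : forall i j : 'I_m, i != j -> l i - l j \is a GRing.unit.

(** This is where the [l i] must differ by units: evaluated at [- l j], a
product of factors [t + l i] with [i != j] is a unit, hence nonzero. *)
Lemma vanishes1 j : ~ vanishes j 1.
Proof.
move=> [s js [p]]; rewrite mul1r -rmorph_prod => /LocPoly.toloc_inj.
move=> /(congr1 (fun p => p.[- l j])); rewrite hornerM !hornerE addNr mulr0.
rewrite horner_prod => e0.
have : \prod_(i <- s) ('X + (l i)%:P).[- l j] \is a GRing.unit.
  elim: s js {e0} => [|i s IH]; first by rewrite big_nil unitr1.
  rewrite inE negb_or eq_sym => /andP[ij /IH us].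
  by rewrite big_cons unitrM us !hornerE addrC hl.
by rewrite e0 unitr0.
Qed.

Lemma mon_inj : injective mon.
Proof.
suff lt j k k' : mon k = mon k' -> k 0 j < k' 0 j -> False.
  move=> k k' e; apply/rowP => j.
  by case: (ltgtP (k 0 j) (k' 0 j)) => // [/(lt _ _ _ e)|/(lt _ _ _ (esym e))].
move=> e kk'; apply: (@vanishes1 j); rewrite -(monVr k) e -monD.
by apply: vanishes_mon; rewrite !mxE subr_gt0.
Qed.

(** The tropical relation: of the orders [a 0 j], [b 0 j] and [0] of the three
terms, the least one occurs at least twice. *)
Lemma mon_sub_const j (a b : 'rV[int]_m) (c : A) :
    c \is a GRing.unit -> mon a - mon b = toloc c%:P ->
  (a 0 j < 0 -> b 0 j = a 0 j) /\ (0 < a 0 j -> b 0 j = 0).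
Proof.
move=> uc eab.
have cV : toloc (c^-1)%:P * toloc c%:P = 1.
  by rewrite -rmorphM -rmorphM /= mulVr // rmorph1.
(* After division by a pole of strictly least order, 1 would vanish. *)
have pole (x y : 'rV[int]_m) (e : A) : mon x = mon y + toloc e%:P ->
    x 0 j < 0 -> x 0 j < y 0 j -> False.
  move=> exy x0 xy; apply: (@vanishes1 j); rewrite -(monVr x) {1}exy mulrDl.
  rewrite -monD mulrC; apply: vanishesD.
    by apply: vanishes_mon; rewrite !mxE subr_gt0.
  by apply/vanishesM/vanishes_mon; rewrite mxE oppr_gt0.
have zero : 0 < a 0 j -> 0 < b 0 j -> False.
  move=> a0 b0; apply: (@vanishes1 j); rewrite -cV mulrC -eab.
  apply: vanishesM; apply: vanishesD; first exact: vanishes_mon.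
  exact/vanishesN/vanishes_mon.
have eab1 : mon a = mon b + toloc c%:P by rewrite -eab addrC subrK.
have eab2 : mon b = mon a + toloc (- c)%:P.
  by rewrite polyCN rmorphN /= -eab opprB addrC subrK.
have := pole _ _ _ eab1; have := pole _ _ _ eab2; move: zero.
move: (a 0 j) (b 0 j) => x y.
by lia.
Qed.

(** * The affine group in coordinates *)

Lemma affmx_inj (u v p r : R) : affmx u p = affmx v r -> u = v /\ p = r.
Proof.
move=> e; have [eu ep _ _] := @eq_block_mx _ 1 1 1 1 _ _ _ _ _ _ _ _ e.
by split; [move: eu|move: ep] => /matrixP/(_ 0 0); rewrite !mxE.
Qed.

Fact aff_subproof (k : 'rV[int]_m) (P : R) : in_Gamma (affmx (mon k) P).
Proof. by apply/asboolP; exists (k 0), P. Qed.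

Definition aff k P : Gamma l := MkGamma (aff_subproof k P).

Lemma affM j k P Q : (aff j P * aff k Q)%g = aff (j + k) (mon j * Q + P).
Proof. by apply: val_inj; rewrite /= mul_affmx monD. Qed.

Lemma aff1 : aff 0 0 = 1%g.
Proof. by apply: val_inj; rewrite /= mon0 affmx10. Qed.

Lemma aff_inj j k P Q : aff j P = aff k Q -> j = k /\ P = Q.
Proof. by move=> /(congr1 val)/affmx_inj[/mon_inj]. Qed.

Lemma Gamma_aff (g : Gamma l) : exists kP, g = aff kP.1 kP.2.
Proof.
case: g => M gM; have [k [P eM]] := asboolP _ gM.
exists (\row_i k i, P); apply: val_inj; rewrite /= eM; congr affmx.
by apply: eq_bigr => i _; rewrite mxE.
Qed.

Definition expo (g : Gamma l) : 'rV[int]_m := (sval (cid (Gamma_aff g))).1.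
Definition trans (g : Gamma l) : R := (sval (cid (Gamma_aff g))).2.

Lemma aff_expo_trans g : g = aff (expo g) (trans g).
Proof. by rewrite /expo /trans; case: cid. Qed.

Lemma expo_aff k P : expo (aff k P) = k.
Proof. by have /aff_inj[] := aff_expo_trans (aff k P). Qed.

Lemma trans_aff k P : trans (aff k P) = P.
Proof. by have /aff_inj[] := aff_expo_trans (aff k P). Qed.

Lemma expoM g h : expo (g * h)%g = expo g + expo h.
Proof. by rewrite [g]aff_expo_trans [h]aff_expo_trans affM !expo_aff. Qed.

Lemma expo1 : expo 1%g = 0.
Proof. by rewrite -aff1 expo_aff. Qed.

Lemma expoX g n : expo (g ^+ n)%g = expo g *+ n.
Proof.
elim: n => [|n IH]; first by rewrite expo1 mulr0n.
by rewrite expgS expoM IH mulrS.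
Qed.

Lemma aff0X P n : (aff 0 P ^+ n)%g = aff 0 (P *+ n).
Proof.
elim: n => [|n IH]; first by rewrite mulr0n aff1.
by rewrite expgS IH affM mon0 mul1r addr0 mulrSr.
Qed.

(** * The action of an automorphism *)

Section Endomorphism.
Variable q : nat.
Hypotheses (q_gt0 : (0 < q)%N) (q0 : q%:R = 0 :> A).
Hypothesis cyclicA : forall a : A, exists n : nat, a = n%:R.

Lemma loc_mulrn_q (P : R) : P *+ q = 0.
Proof.
by rewrite -mulr_natr -(rmorph_nat toloc) -(rmorph_nat polyC) q0 !rmorph0 mulr0.
Qed.

Lemma expo_torsion g : (g ^+ q)%g = 1%g -> expo g = 0.
Proof.
move=> /(congr1 expo); rewrite expoX expo1 => e.
apply/rowP => i; move/rowP/(_ i): e; rewrite !mxE => /eqP.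
by rewrite mulmxnE mulrn_eq0 (gtn_eqF q_gt0) => /eqP.
Qed.

Lemma aff0_torsion P : (aff 0 P ^+ q)%g = 1%g.
Proof. by rewrite aff0X loc_mulrn_q aff1. Qed.

Variable phi : {multiplicative Gamma l -> Gamma l}.

Let phiM : {morph phi : x y / (x * y)%g}. Proof. exact: gmulfM. Qed.

Let phiX g n : phi (g ^+ n)%g = (phi g ^+ n)%g.
Proof.
by elim: n => [|n IH]; rewrite ?expgS ?phiM ?IH //; exact: mul_morph1.
Qed.

Definition expo_map (k : 'rV[int]_m) : 'rV[int]_m := expo (phi (aff k 0)).
Definition trans_map (P : R) : R := trans (phi (aff 0 P)).
Local Notation beta := expo_map.
Local Notation psi := trans_map.

(** The normal subgroup [R] is characteristic: it consists of torsion elements,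
and the quotient by it is torsion free. *)
Lemma phi_aff0 P : phi (aff 0 P) = aff 0 (psi P).
Proof.
rewrite [LHS]aff_expo_trans; congr aff; apply: expo_torsion.
by rewrite -phiX aff0_torsion; exact: mul_morph1.
Qed.

Lemma expo_phi g : expo (phi g) = beta (expo g).
Proof.
rewrite {1}[g]aff_expo_trans.
have -> : aff (expo g) (trans g) = (aff 0 (trans g) * aff (expo g) 0)%g.
  by rewrite affM mon0 mul1r !add0r.
by rewrite phiM expoM phi_aff0 expo_aff add0r.
Qed.

Lemma expo_mapD j k : beta (j + k) = beta j + beta k.
Proof. by rewrite -expoM -phiM affM mulr0 addr0. Qed.

Lemma expo_map0 : beta 0 = 0.
Proof. by apply: (@addrI _ (beta 0)); rewrite -expo_mapD !addr0. Qed.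

Lemma expo_mapZ (z : int) k : beta (z *: k) = z *: beta k.
Proof.
have betaMn n : beta (n%:R *: k) = n%:R *: beta k.
  elim: n => [|n IH]; first by rewrite !scale0r expo_map0.
  by rewrite mulrS !scalerDl expo_mapD IH !scale1r.
case: z => n; first by rewrite -[Posz n]natz.
rewrite NegzE -[Posz n.+1]natz; apply: (@addrI _ (beta (n.+1%:R *: k))).
by rewrite -expo_mapD scaleNr subrr expo_map0 betaMn scaleNr subrr.
Qed.

Lemma expo_mapE k : beta k = \sum_i k 0 i *: beta (delta_mx 0 i).
Proof.
rewrite {1}[k]row_sum_delta (big_morph beta expo_mapD expo_map0).
by apply: eq_bigr => i _; rewrite expo_mapZ.
Qed.

Lemma trans_mapD P Q : psi (P + Q) = psi P + psi Q.
Proof.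
have := phiM (aff 0 Q) (aff 0 P).
rewrite affM addr0 !phi_aff0 affM !mon0 !mul1r.
by case/aff_inj.
Qed.

Lemma trans_map0 : psi 0 = 0.
Proof. by apply: (@addrI _ (psi 0)); rewrite -trans_mapD !addr0. Qed.

Lemma trans_mapMn P n : psi (P *+ n) = psi P *+ n.
Proof.
elim: n => [|n IH]; first by rewrite !mulr0n trans_map0.
by rewrite !mulrS trans_mapD IH.
Qed.

(** Conjugation by a monomial acts on [R] as multiplication by it. *)
Lemma trans_map_mon k P : psi (mon k * P) = mon (beta k) * psi P.
Proof.
have : (aff k 0 * aff 0 P)%g = (aff 0 (mon k * P)%R * aff k 0)%g.
  by rewrite !affM mon0 !addr0 mulr0 !add0r.
move=> /(congr1 phi); rewrite !phiM !phi_aff0.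
rewrite [phi (aff k 0)]aff_expo_trans expo_phi expo_aff !affM.
by rewrite mon0 mul1r [trans _ + _]addrC => /aff_inj[_ /addIr].
Qed.

Lemma natr_const (P : R) n : toloc (n%:R)%:P * P = P *+ n.
Proof. by rewrite !rmorph_nat mulr_natl. Qed.

Hypothesis phi_bij : bijective phi.

Lemma expo_map_surj k : exists j, beta j = k.
Proof.
have [phi' _ phiK] := phi_bij; exists (expo (phi' (aff k 0))).
by rewrite -expo_phi phiK expo_aff.
Qed.

Lemma trans_map_surj Q : exists P, psi P = Q.
Proof.
have [phi' phi'K phiK] := phi_bij; pose g := phi' (aff 0 Q).
have eg : expo g = 0.
  apply: expo_torsion; apply: (bij_inj phi_bij).
  by rewrite phiX phiK aff0_torsion mul_morph1.
exists (trans g); rewrite /trans_map -eg -aff_expo_trans phiK.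
exact: trans_aff.
Qed.

(** The linear relations between the [x_i] annihilate [R], and [psi] transports
this to their images. *)
Lemma mon_expo_map_sub i k :
  mon (beta (delta_mx 0 i)) - mon (beta (delta_mx 0 k)) = toloc (l i - l k)%:P.
Proof.
have [P psiP] := trans_map_surj 1; have [n en] := cyclicA (l i - l k).
have e : mon (delta_mx 0 i) * P = mon (delta_mx 0 k) * P + P *+ n.
  rewrite -natr_const -en -mulrDl !mon_delta -[gen k + _]rmorphD.
  by congr (toloc _ * _); rewrite rmorphB /=; ring.
move/(congr1 psi): e; rewrite trans_mapD trans_mapMn !trans_map_mon psiP !mulr1.
by move=> ->; rewrite addrAC subrr add0r en -[RHS]mulr1 natr_const.
Qed.

Definition expo_mx : 'M[int]_m := \matrix_i beta (delta_mx 0 i).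

Lemma expo_map_mx k : beta k = k *m expo_mx.
Proof.
by rewrite expo_mapE mulmx_sum_row; apply: eq_bigr => i _; rewrite rowK.
Qed.

(** A fixed [w] gives a homomorphism [g |-> expo g *m w] to [Z] that [phi]
preserves; it is constant on twisted classes and has infinite image. *)
Lemma infinite_twisted_of_fixed (w : 'cV[int]_m) :
  w != 0 -> expo_mx *m w = w -> infinite_set (twisted_classes phi).
Proof.
move=> /eqP w0 Bw.
have [i wi] : exists i, w i 0 != 0.
  apply/not_existsP => wn; apply: w0; apply/colP => i; rewrite mxE.
  by apply/eqP/negP => /negP/wn.
pose F n := aff (delta_mx 0 i *+ n) 0.
apply: (@infinite_twisted_classes _ phi phiM F).
move=> a b [s /(congr1 (fun g => g * phi s)%g)]; rewrite mulgVK.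
move=> /(congr1 (fun g => (expo g *m w) 0 0)).
rewrite !expoM !expo_aff expo_phi expo_map_mx !mulmxDl -mulmxA Bw addrC.
rewrite mxE [RHS]mxE => /addIr; rewrite -!scaler_nat -!scalemxAl -rowE !mxE.
by move=> /(mulIf wi)/eqP; rewrite eqr_nat => /eqP.
Qed.

(** Let [B] be [expo_mx].  If no column is [(-1, .., -1)], then [B]
permutes the coordinates and fixes [(1, .., 1)].  Otherwise let [r] be the exceptional column.  Each other
column [j] gives a [u_i] equal to [x_j / x_r]; two of them would make
[(x_j - x_j') / x_r] a constant, although its numerator is a unit of [A].
So [r] and one [s] exhaust the indices, and the two possible positions of the
unit vector in column [s] give the two conclusions. *)
Lemma expo_mx_dichotomy : (1 < m)%N ->
  (exists2 w : 'cV[int]_m, w != 0 & expo_mx *m w = w) \/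
  exists r s, [/\ r != s, forall i, i = r \/ i = s,
    beta (delta_mx 0 r) = delta_mx 0 s - delta_mx 0 r &
    beta (delta_mx 0 s) = - delta_mx 0 r].
Proof.
move=> m1.
have tropB i k j : i != k ->
    (expo_mx i j < 0 -> expo_mx k j = expo_mx i j) /\
    (0 < expo_mx i j -> expo_mx k j = 0).
  move=> ik; rewrite !mxE.
  exact: mon_sub_const (hl ik) (mon_expo_map_sub i k).
have surjB (v : 'rV_m) : exists u : 'rV_m, u *m expo_mx = v.
  by have [u <-] := expo_map_surj v; exists u; rewrite expo_map_mx.
have [B1|[r Br Bt]] := tropical_dichotomy tropB surjB.
  left; exists (const_mx 1) => //; apply/eqP => /colP/(_ (Ordinal (ltnW m1))).
  by rewrite !mxE.
have rowB i j : j != r -> col j expo_mx = delta_mx i 0 ->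
    beta (delta_mx 0 i) = delta_mx 0 j - delta_mx 0 r.
  move=> jr Bj; rewrite -(exceptional_row surjB jr Br Bt Bj).
  by rewrite expo_map_mx -rowE.
have uniq_col j j' : j != r -> j' != r -> j = j'.
  move=> jr j'r; apply/eqP/negP => /negP jj'.
  have [i Bi] := Bt _ jr; have [i' Bi'] := Bt _ j'r.
  have ii' : i != i'.
    by apply: contra_neq jj' => ei; apply: (col_inj surjB); rewrite Bi Bi' ei.
  have := mon_expo_map_sub i i'; rewrite (rowB _ _ jr Bi) (rowB _ _ j'r Bi').
  rewrite !monD -mulrBl => /(congr1 ( *%R^~ (mon (delta_mx 0 r)))).
  rewrite -mulrA [mon (- _) * _]mulrC monVr mulr1 !mon_delta -rmorphB /= => e.
  apply: (@vanishes1 r).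
  have -> : 1 = toloc (l j - l j')%:P * toloc (l j - l j')^-1%:P.
    by rewrite -rmorphM -rmorphM /= divrr ?hl // rmorph1.
  apply: vanishesM.
  have -> : (l j - l j')%:P = 'X + (l j)%:P - ('X + (l j')%:P).
    by rewrite rmorphB; ring.
  rewrite e mulrC -mon_delta; apply: vanishesM; apply: vanishes_mon.
  by rewrite mxE !eqxx.
have [s sr] : exists s, s != r.
  have [->|] := eqVneq r (Ordinal m1); last first.
    by exists (Ordinal m1); rewrite eq_sym.
  by exists (Ordinal (ltnW m1)).
have rs i : i = r \/ i = s.
  by have [|ir] := eqVneq i r; [left|right; apply: uniq_col].
have [i Bs] := Bt _ sr; have [ei|ei] := rs i; last first.
  left; exists (delta_mx s 0); last by rewrite -colE Bs ei.
  by apply/eqP => /colP/(_ s); rewrite !mxE !eqxx.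
right; exists r, s; split=> //; first by rewrite eq_sym.
  by rewrite -{1}ei; apply: rowB.
have {}Br : beta (delta_mx 0 s) 0 r = -1.
  by move/colP/(_ s): Br; rewrite !mxE.
have {}Bs : beta (delta_mx 0 s) 0 s = 0.
  by move/colP/(_ s): Bs; rewrite !mxE ei (negPf sr).
apply/rowP => k; rewrite !mxE.
by have [->|->] := rs k; rewrite ?eqxx ?(negPf sr).
Qed.

(** * The 3-cycle of places *)

Section ThreeCycle.
Variables r s : 'I_m.
Hypotheses (rs : r != s) (rsP : forall i, i = r \/ i = s).
Hypothesis beta_r : beta (delta_mx 0 r) = delta_mx 0 s - delta_mx 0 r.
Hypothesis beta_s : beta (delta_mx 0 s) = - delta_mx 0 r.

(** The relation between [1 / x_r] and [x_s / x_r], multiplied by [x_r], reads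
[1 - x_s = (l_s - l_r) x_r].  Its leading coefficients give [l_s - l_r = -1] and
its constant terms then give [l_s - l_r = 1]. *)
Lemma three_cycle_char2 : 2%:R = 0 :> A.
Proof.
have := mon_expo_map_sub s r; rewrite beta_r beta_s.
move/(congr1 ( *%R (mon (delta_mx 0 r)))).
rewrite mulrBr -!monD subrr mon0 [_ + (_ - _)]addrC subrK !mon_delta.
rewrite -(rmorph1 toloc) -rmorphB -rmorphM => /LocPoly.toloc_inj e.
have e0 := congr1 (fun p : {poly A} => p.[0]) e.
have e1 := congr1 (fun p : {poly A} => p.[1]) e.
move: e0 e1; rewrite !hornerE => e0 e1.
have c1 : l s - l r = -1.
  transitivity ((1 + l r) * (l s - l r) - l r * (l s - l r)); first by ring.
  by rewrite -e0 -e1; ring.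
have c2 : l s - l r = 1.
  apply/eqP; rewrite -subr_eq0; apply/eqP.
  transitivity (l r * (l s - l r) - (1 - l s) - l r * (l s - l r + 1)).
    by ring.
  by rewrite -e0 c1; ring.
by rewrite -[2%:R]/(1 + 1) -{1}c2 c1 addNr.
Qed.

Hypothesis char2 : 2%:R = 0 :> A.
Hypothesis units_mon : forall c z : R, c * z = 1 -> exists k, c = mon k.

Let oppR (x : R) : - x = x.
Proof.
apply/eqP; rewrite -subr_eq0 -opprD oppr_eq0 -mulr2n -mulr_natr.
by rewrite -(rmorph_nat toloc) -(rmorph_nat polyC) char2 !rmorph0 mulr0.
Qed.

Let vec (a b : int) : 'rV[int]_m := a *: delta_mx 0 r + b *: delta_mx 0 s.

Let vec_r a b : vec a b 0 r = a.
Proof. by rewrite !mxE !eqxx (negPf rs) mulr1 mulr0 addr0. Qed.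

Let vec_s a b : vec a b 0 s = b.
Proof. by rewrite !mxE !eqxx eq_sym (negPf rs) mulr1 mulr0 add0r. Qed.

Let vecP (k : 'rV[int]_m) : k = vec (k 0 r) (k 0 s).
Proof. by apply/rowP => i; have [->|->] := rsP i; rewrite (vec_r, vec_s). Qed.

Let vecD a b a' b' : vec a b + vec a' b' = vec (a + a') (b + b').
Proof. by rewrite addrACA -!scalerDl. Qed.

Let beta_vec a b : beta (vec a b) = vec (- a - b) a.
Proof.
rewrite expo_mapD !expo_mapZ beta_r beta_s scalerBr scalerN /vec.
by rewrite scalerBl scaleNr -addrA addrC.
Qed.

(** Since [beta] has no nonzero fixed vector, elements with the same exponent
[u] are twisted conjugate only through elements of [R], which changes the [R]
component by some [S - x^u psi S].  Choosing [u] so that [x^u psi] fixes [1]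
turns it into a map [rho] of order 3 sending monomials to monomials.  The trace
[T = 1 + rho + rho ^ 2] kills all [S - rho S], and
[T (x_r ^ n) = x_r ^ n + (x_s / x_r) ^ n + 1 / x_s ^ n] has a pole of order
exactly [n] at the place [r]. *)
Lemma infinite_twisted_three_cycle : infinite_set (twisted_classes phi).
Proof.
have m0 : (0 < m)%N by apply: leq_ltn_trans (ltn_ord r).
have [P1 psi1] := trans_map_surj 1.
(* [psi 1] is a unit: the image of [psi] lies in the ideal it generates. *)
have [z cz] : exists z, psi 1 * z = 1.
  suff [z cz] : exists z, psi P1 = psi 1 * z by exists z; rewrite -cz.
  apply: (@loc_ind (fun P => exists z, psi P = psi 1 * z) m0 cyclicA).
  - by exists 0; rewrite trans_map0 mulr0.
  - move=> x y [a ea] [b eb]; exists (a + b).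
    by rewrite trans_mapD ea eb mulrDr.
  - move=> k; exists (mon (beta k)).
    by rewrite -[mon k]mulr1 trans_map_mon mulrC.
have [c ec] := units_mon cz.
pose rho P := mon (- c) * psi P.
have rhoD P Q : rho (P + Q) = rho P + rho Q.
  by rewrite /rho trans_mapD mulrDr.
have rho0 : rho 0 = 0 by rewrite /rho trans_map0 mulr0.
have rho_mon a b : rho (mon (vec a b)) = mon (vec (- a - b) a).
  rewrite /rho -[mon (vec a b)]mulr1 trans_map_mon beta_vec ec mulrCA.
  by rewrite [mon (- c) * _]mulrC monVr mulr1.
have rho3 P : rho (rho (rho P)) = P.
  pose Q P := rho (rho (rho P)) = P.
  apply: (@loc_ind Q m0 cyclicA) => [|{}P P' eP eP'|k]; rewrite /Q.
  - by rewrite !rho0.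
  - by rewrite !rhoD eP eP'.
  - rewrite {1}[k]vecP !rho_mon [in RHS](vecP k).
    by congr (mon (vec _ _)); ring.
pose T P := P + rho P + rho (rho P).
have TD P Q : T (P + Q) = T P + T Q by rewrite /T !rhoD; ring.
have Trho P : T (rho P) = T P by rewrite /T rho3; ring.
pose e n := vec (Posz n) 0.
have T_inj a b : (a < b)%N -> T (mon (e a)) <> T (mon (e b)).
  (* Multiplied by x_r ^ b, the pole of order b becomes the invertible term
     x_s ^ b, while the five other terms vanish at r. *)
  move=> ab; rewrite /T /e !rho_mon.
  move=> /(congr1 ( *%R (mon (vec (Posz b) 0)))).
  rewrite !mulrDr -!monD !vecD !(oppr0, addr0, add0r, subr0, subrr, opprK).
  move=> eT.
  apply: (@vanishes1 r); rewrite -(monVr (vec 0 (Posz b))).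
  apply: vanishes_mulmon; first by rewrite mxE vec_r oppr0.
  set x := mon (vec 0 _) in eT *.
  have -> : x = mon (vec (Posz b + Posz b) 0) +
      mon (vec (Posz b) (- Posz b)) +
      (mon (vec (Posz b + Posz a) 0) + mon (vec (Posz b - Posz a) (Posz a)) +
       mon (vec (Posz b) (- Posz a))).
    by rewrite eT -[X in _ = X + _]oppR; ring.
  do !apply: vanishesD; apply: vanishes_mon; rewrite vec_r; lia.
pose F n := aff (- c) (mon (e n)).
apply: (@infinite_twisted_classes _ phi phiM F).
suff T_class a b : twisted_conj phi (F a) (F b) ->
    T (mon (e a)) = T (mon (e b)).
  move=> a b /T_class eT.
  by case: (ltngtP a b) => // [/T_inj|/T_inj]; case.
move=> [g /(congr1 (fun h => h * phi g)%g)]; rewrite mulgVK /F.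
rewrite [g]aff_expo_trans; set v := expo g; set S := trans g => eg.
have v0 : v = 0.
  move/(congr1 expo): eg; rewrite !expoM expo_phi !expo_aff addrC => /addrI.
  rewrite [v]vecP beta_vec => ev.
  have := congr1 (fun k : 'rV_m => k 0 r) ev.
  have := congr1 (fun k : 'rV_m => k 0 s) ev.
  rewrite !vec_r !vec_s => e1 e2.
  have -> : v 0 s = 0 by lia.
  have -> : v 0 r = 0 by lia.
  by rewrite /vec !scale0r addr0.
move: eg; rewrite v0 phi_aff0 !affM mon0 mul1r => /aff_inj[_ /(congr1 T)].
by rewrite !TD -/(rho S) Trho addrC => /addrI.
Qed.

End ThreeCycle.
End Endomorphism.
End Monomials.

(** * Units over a field *)

(** The numerators of a unit and of its inverse multiply to a product of factors
[t + l i], so unique factorization in [F[t]] leaves no other factors. *)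
Lemma locpoly_unit (F : fieldType) (m : nat) (l : 'I_m -> F) (c z : locpoly l) :
  c * z = 1 -> exists a k, a != 0 /\ c = LocPoly.toloc l a%:P * mon l k.
Proof.
move=> cz; have [s1 [p ep]] := loc_frac c; have [s2 [p' ep']] := loc_frac z.
have epp : p * p' = \prod_(i <- s1 ++ s2) ('X - (- l i)%:P).
  apply: (@LocPoly.toloc_inj _ _ l).
  rewrite rmorphM /= -ep -ep' mulrACA cz mul1r -big_cat rmorph_prod.
  apply: eq_bigr => i _.
  by rewrite polyCN opprK.
have : p %| \prod_(i <- s1 ++ s2) ('X - (- l i)%:P) by rewrite -epp dvdp_mulr.
move=> /dvdp_prod_XsubC[b]; set s := mask b _ => /eqpf_eq[a a0 e].
exists a, (\sum_(i <- s) delta_mx 0 i - \sum_(i <- s1) delta_mx 0 i).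
split=> //.
rewrite monD -prod_gen mulrA.
have -> : LocPoly.toloc l a%:P * \prod_(i <- s) locgen l i = LocPoly.toloc l p.
  rewrite e -mul_polyC rmorphM rmorph_prod; congr (_ * _).
  by apply: eq_bigr => i _; rewrite polyCN opprK.
by rewrite -ep prod_gen -mulrA monVr mulr1.
Qed.

(** * Property R-infinity *)

Theorem theorem4p3 (d q : nat) (l : 'I_d.-1 -> 'Z_q) :
  (2 <= q)%N ->
  (forall p : nat, prime p -> (p %| q)%N -> (d <= p.+1)%N) ->
  (forall i : 'I_d.-1, nat_of_ord i = 0%N -> l i = 0) ->
  (forall i j : 'I_d.-1, i != j -> l i - l j \is a GRing.unit) ->
  (3 <= d)%N ->
  has_Rinfty (Gamma l).
Proof.
move=> q2 _ _ hl d3 phi phi_bij.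
have q_gt0 : (0 < q)%N by apply: ltnW.
have q0 : q%:R = 0 :> 'Z_q by apply: pchar_Zp.
have cyc (a : 'Z_q) : exists n : nat, a = n%:R by exists a; rewrite natr_Zp.
have d1 : (1 < d.-1)%N by case: d d3 {l hl phi phi_bij} => [|[|[|]]].
have [[w w0 Bw]|[r [s [rs rsP er es]]]] :=
    expo_mx_dichotomy hl q_gt0 q0 cyc phi_bij d1.
  exact: (infinite_twisted_of_fixed hl q_gt0 q0 w0 Bw).
have c2 := three_cycle_char2 hl q_gt0 q0 cyc phi_bij er es.
have {d1 d3} eq2 : q = 2.
  have /(congr1 (@nat_of_ord _)) := c2; rewrite val_Zp_nat //=.
  move=> /eqP/dvdn_leq-/(_ isT) le2.
  by apply/eqP; rewrite eqn_leq le2.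
subst q.
apply: (infinite_twisted_three_cycle hl q_gt0 q0 cyc phi_bij rs rsP er es c2).
(* 'Z_2 is convertible to the field 'F_2, whose only nonzero element is 1. *)
move=> c z cz; have [a [k [a0 ->]]] := @locpoly_unit 'F_2 _ l c z cz; exists k.
suff -> : a = 1 by rewrite rmorph1 mul1r.
by case: a a0 => [[|[|n]] ln] //= _; apply: val_inj.
Qed.
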